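(* Let $n,m$ be integers with $n\geq 2$ and $m\geq 6n$. Then $K_{2n+1}^{\star m}\notin\mathfrak{N}_{c}$.
   Context: All graphs are finite, undirected, without loops or multiple edges. Let $K_{2n+1}$ be the complete graph with vertex set $\{v_{1},\ldots,v_{2n+1}\}$. For positive integers $m,n$, the graph $K_{2n+1}^{\star m}$ is defined by $V(K_{2n+1}^{\star m})=V(K_{2n+1})\cup\{u,w_{1},\ldots,w_{m}\}$ (with $u,w_1,\ldots,w_m$ new distinct vertices) and $E(K_{2n+1}^{\star m})=E(K_{2n+1})\cup\{v_{1}u\}\cup\{uw_{i}: 1\leq i\leq m\}$. For a positive integer $t$, an interval cyclic $t$-coloring of a graph $G$ is a proper edge-coloring of $G$ with colors $1,\ldots,t$ such that all $t$ colors are used and, for each vertex $v$, the edges incident to $v$ are colored by $d_{G}(v)$ consecutive colors modulo $t$ (i.e. consecutive in the cyclic order $1,2,\ldots,t,1$), where $d_G(v)$ is the degree of $v$. $\mathfrak{N}_{c}$ is the set of graphs having an interval cyclic $t$-coloring for some positive integer $t$. *)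

(* Defs.v *)
From mathcomp Require Import all_boot.

Set Implicit Arguments.
Unset Strict Implicit.
Unset Printing Implicit Defensive.

Record sgraph := SGraph {
  vertex :> finType;
  adj : rel vertex;
  adj_sym : symmetric adj;
  adj_irrefl : irreflexive adj }.

Section IntervalCyclicColoring.
Variable G : sgraph.

Definition edges : {set {set G}} :=
  [set [set p.1; p.2] | p : G * G & adj p.1 p.2].

Definition degree (v : G) : nat := #|[set x | adj v x]|.

(* A coloring is a function on all sets of vertices; only its values on [edges]
   are ever constrained. *)
Definition proper_edge_coloring (c : {set G} -> nat) : Prop :=
  forall e f : {set G}, e \in edges -> f \in edges ->
    e != f -> e :&: f != set0 -> c e != c f.

(* The residue of [a + j] is shifted by one because the colors are 1, ..., t. *)
Definition consecutive_mod_at (t : nat) (c : {set G} -> nat) (v : G) : Prop :=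
  exists a : nat, forall k : nat,
    (exists e : {set G}, [/\ e \in edges, v \in e & c e = k]) <->
    (exists2 j : nat, j < degree v & k = ((a + j) %% t).+1).

Definition interval_cyclic_coloring (t : nat) (c : {set G} -> nat) : Prop :=
  [/\ forall e : {set G}, e \in edges -> 1 <= c e <= t,
      proper_edge_coloring c,
      forall k : nat, 1 <= k <= t -> exists2 e : {set G}, e \in edges & c e = k
    & forall v : G, consecutive_mod_at t c v].

Definition interval_cyclic_colorable : Prop :=
  exists2 t : nat, 0 < t & exists c : {set G} -> nat,
    interval_cyclic_coloring t c.

End IntervalCyclicColoring.

Section KStar.
Variables n m : nat.

(* [inl i] is v_(i+1), [inr None] is u and [inr (Some i)] is w_(i+1). *)
Definition Kstar_vertex : finType := ('I_(2 * n).+1 + option 'I_m)%type.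

Definition Kstar_adj (x y : Kstar_vertex) : bool :=
  match x, y with
  | inl i, inl j => i != j
  | inl i, inr None | inr None, inl i => i == ord0
  | inr None, inr (Some _) | inr (Some _), inr None => true
  | _, _ => false
  end.

Lemma Kstar_adj_sym : symmetric Kstar_adj.
Proof. by move=> [i|[i|]] [j|[j|]] //=; rewrite eq_sym. Qed.

Lemma Kstar_adj_irrefl : irreflexive Kstar_adj.
Proof. by move=> [i|[i|]] //=; rewrite eqxx. Qed.

Definition Kstar : sgraph := SGraph Kstar_adj_sym Kstar_adj_irrefl.

End KStar.

(* Main.v *)
Require Import Defs.
From mathcomp Require Import all_boot.
From mathcomp Require Import zify.

(** Suppose that there is an interval cyclic [t]-coloring.  The [m] edges
    [u w_i] have distinct colors, so [t >= m >= 6 n].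

    The colors at [v_1] form a cyclic interval of length [2 n + 1]; rotate the
    colors so that this interval becomes [2 n - 1, ..., 4 n - 1].  Every other
    vertex [v_i] is joined to [v_1], and has [2 n] cyclically consecutive colors,
    so all its colors lie between [0] and [6 n - 2 < t]: the cyclic interval at
    [v_i] does not wrap around, and is an interval of [2 n] integers
    ([cyclic_interval_unwrap]).

    Now reduce the rotated colors modulo [2 n].  Each residue occurs exactly once
    at every [v_i] with [i > 1], and each residue other than [2 n - 1] occurs
    exactly once at [v_1].  Since [2 n >= 3], some residue [r != 2 n - 1] is not
    that of the edge [v_1 u].  The edges of residue [r] then form a perfect
    matching of [K_(2n+1)], which has an odd number of vertices: a contradiction
    ([perfect_matching_even]). *)

Set Implicit Arguments.
Unset Strict Implicit.
Unset Printing Implicit Defensive.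

(** A symmetric irreflexive relation in which every point has exactly one
    neighbour is a perfect matching: taking neighbours exchanges the points that
    are smaller than their neighbour with those that are larger. *)
Lemma perfect_matching_even (N : nat) (e : rel 'I_N) :
  symmetric e -> irreflexive e ->
  (forall i, exists j, e i j) ->
  (forall i j k, e i j -> e i k -> j = k) ->
  ~~ odd N.
Proof.
move=> e_sym e_irr e_ex e_uniq.
pose f i := xchoose (e_ex i).
have ef i : e i (f i) by exact: xchooseP.
have fK : involutive f.
  by move=> i; apply: (e_uniq (f i)) => //; rewrite e_sym.
have f_neq i : f i != i.
  by apply/eqP => fi; have := ef i; rewrite fi e_irr.
pose A := [set i : 'I_N | i < f i].
have AC : ~: A = f @: A.
  apply/setP => i; rewrite inE -{2}(fK i) (mem_imset _ _ (inv_inj fK)).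
  by rewrite !inE fK -leqNgt ltn_neqAle (inj_eq val_inj) f_neq.
have := cardsC A; rewrite AC (card_imset _ (inv_inj fK)) card_ord => <-.
by rewrite addnn odd_double.
Qed.

(** A cyclic interval of length [d] modulo [t] having an element [x] with
    [d - 1 <= x <= t - d] does not wrap around. *)
Lemma cyclic_interval_unwrap (t d b j0 : nat) :
  j0 < d -> d <= ((b + j0) %% t).+1 -> (b + j0) %% t + d <= t ->
  exists s, forall j, j < d -> (b + j) %% t = s + j.
Proof.
set x := (b + j0) %% t => j0d dx xd; exists (x - j0) => j jd.
have lt_t : x - j0 + j < t by lia.
rewrite -[RHS](modn_small lt_t); apply/eqP.
rewrite -(eqn_modDr j0) -addnA (addnC j) addnA -modnDml -/x.
by apply/eqP; congr (_ %% _); lia.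
Qed.

Lemma interval_residue_exists (D s r : nat) :
  r < D -> exists2 j, j < D & (s + j) %% D = r.
Proof.
move=> rD; have D0 : 0 < D by exact: leq_ltn_trans rD.
exists ((r + (D - s %% D)) %% D); first by rewrite ltn_pmod.
rewrite modnDmr -modnDml addnCA subnKC; last exact/ltnW/ltn_pmod.
by rewrite modnDr modn_small.
Qed.

Lemma interval_residue_inj (D s j k : nat) :
  j < D -> k < D -> (s + j) %% D = (s + k) %% D -> j = k.
Proof.
by move=> jD kD /eqP; rewrite eqn_modDl !modn_small // => /eqP.
Qed.

(** * Edges and colors at a vertex *)

Section Graph.
Variable G : sgraph.
Implicit Types (v x y : G) (c : {set G} -> nat).

Lemma adj_edge v x : adj v x -> [set v; x] \in edges G.
Proof. by move=> vx; apply/imsetP; exists (v, x); rewrite ?inE. Qed.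

Lemma edge_at (e : {set G}) v : e \in edges G -> v \in e ->
  exists2 x, adj v x & e = [set v; x].
Proof.
case/imsetP => -[p q]; rewrite inE /= => pq -> /set2P[] ->; first by exists q.
by exists p; rewrite 1?adj_sym 1?setUC.
Qed.

Lemma proper_edge_coloring_inj c v x y : proper_edge_coloring c ->
  adj v x -> adj v y -> c [set v; x] = c [set v; y] -> x = y.
Proof.
move=> c_proper vx vy cxy; have [//|xy] := eqVneq x y.
have xNv : x != v by apply: contraTneq vx => ->; rewrite adj_irrefl.
have eN : [set v; x] != [set v; y].
  apply/eqP => /setP/(_ x); rewrite !inE eqxx orbT => /esym.
  by rewrite (negbTE xNv) (negbTE xy).
have meet : [set v; x] :&: [set v; y] != set0.
  by apply/set0Pn; exists v; rewrite !inE eqxx.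
have := c_proper _ _ (adj_edge vx) (adj_edge vy) eN meet.
by rewrite cxy eqxx.
Qed.

Lemma consecutive_mod_at_adj t c v : consecutive_mod_at t c v -> exists a,
  (forall x, adj v x ->
     exists2 j, j < degree v & c [set v; x] = ((a + j) %% t).+1) /\
  (forall j, j < degree v ->
     exists2 x, adj v x & c [set v; x] = ((a + j) %% t).+1).
Proof.
case=> a Ha; exists a; split=> [x vx|j jd].
  by apply/Ha; exists [set v; x]; rewrite adj_edge // !inE eqxx.
have [|e [eE ve ce]] := proj2 (Ha ((a + j) %% t).+1); first by exists j.
by have [x vx eq_e] := edge_at eE ve; exists x; rewrite // -eq_e.
Qed.

(** The colors at distinct neighbours of [v] are distinct elements of
    [{1, ..., t}]. *)
Lemma proper_edge_coloring_leq t c v (k : nat) (f : 'I_k -> G) :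
  (forall e, e \in edges G -> 1 <= c e <= t) -> proper_edge_coloring c ->
  injective f -> (forall i, adj v (f i)) -> k <= t.
Proof.
move=> c_rng c_proper f_inj vf.
have rng i : 1 <= c [set v; f i] <= t by apply/c_rng/adj_edge.
have lt_t i : (c [set v; f i]).-1 < t by have := rng i; lia.
suff g_inj : injective (fun i => Ordinal (lt_t i)).
  by have := leq_card _ g_inj; rewrite !card_ord.
move=> i j /(congr1 val) /= cij; apply/f_inj.
apply: (proper_edge_coloring_inj c_proper (vf i) (vf j)).
by have := rng i; have := rng j; lia.
Qed.

End Graph.

(** * The graph [K_(2n+1)] with an attached star *)

Section Kstar.
Variables n m : nat.
Notation G := (Kstar n m).

Lemma degree_clique (i : 'I_(2 * n).+1) :
  degree (inl i : G) = 2 * n + (i == ord0).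
Proof.
rewrite /degree.
have inlI : injective (inl : 'I_(2 * n).+1 -> G) by move=> ? ? [].
pose N : {set G} := inl @: [set~ i].
have cN : #|N| = 2 * n by rewrite (card_imset _ inlI) cardsC1 card_ord.
have [i0|iN0] := boolP (i == ord0); last first.
  rewrite addn0 -[RHS]cN; apply: eq_card => -[j|[w|]]; rewrite !inE /=.
  - by rewrite (mem_imset _ _ inlI) !inE eq_sym.
  - by apply/esym/imsetP => -[].
  - by rewrite (negbTE iN0); apply/esym/imsetP => -[].
have uN : (inr None : G) \notin N by apply/imsetP => -[].
transitivity #|inr None |: N|; last by rewrite cardsU1 uN cN addnC.
apply: eq_card => -[j|[w|]]; rewrite !inE /=.
- by rewrite (mem_imset _ _ inlI) !inE eq_sym.
- by apply/esym/imsetP => -[].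
- by rewrite i0.
Qed.

End Kstar.

Theorem theorem37 (n m : nat) (hn : 2 <= n) (hm : 6 * n <= m) :
  ~ interval_cyclic_colorable (Kstar n m).
Proof.
set G := Kstar n m.
case=> t t_gt0 [c [c_rng c_proper _ c_consec]].
have le_t : 6 * n <= t.
  apply: leq_trans hm _.
  apply: (@proper_edge_coloring_leq G t c (inr None) m
            (fun i => inr (Some i))) => //.
  by move=> i j [].
pose v (i : 'I_(2 * n).+1) : G := inl i.
pose u : G := inr None.
have [a [a_adj a_ex]] := consecutive_mod_at_adj (c_consec (v ord0)).
rewrite degree_clique eqxx addn1 in a_adj a_ex.
(* [h] is minus [a + 1] plus [2 n - 1] modulo [t]; the rotation by [h] sends
   the smallest color at [v_1] to [2 n - 1]. *)
pose h := (2 * n).-1 + t.-1 * a.+1.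
pose phi (x y : G) := (c [set x; y] + h) %% t.
have phiC x y : phi x y = phi y x by rewrite /phi setUC.
have phi_mod b j x y : c [set x; y] = ((b + j) %% t).+1 ->
    phi x y = (b + h.+1 + j) %% t.
  move=> cE; rewrite /phi cE addSnnS modnDml; congr (_ %% _); lia.
have phi_inj x y z : adj x y -> adj x z -> phi x y = phi x z -> y = z.
  move=> xy xz /eqP; rewrite /phi eqn_modDr => cc.
  apply: (proper_edge_coloring_inj c_proper xy xz).
  have := c_rng _ (adj_edge xy); have := c_rng _ (adj_edge xz).
  move: cc; move: (c _) (c _) => p q pq p_rng q_rng.
  have p_lt : p.-1 < t by lia.
  have q_lt : q.-1 < t by lia.
  have : p.-1 + 1 == q.-1 + 1 %[mod t] by rewrite !addn1 !prednK //; lia.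
  by rewrite eqn_modDr !modn_small // => /eqP; lia.
have shift0 j : j <= 2 * n -> (a + h.+1 + j) %% t = (2 * n).-1 + j.
  move=> jn.
  have -> : a + h.+1 + j = a.+1 * t + ((2 * n).-1 + j).
    rewrite /h -{2}(prednK t_gt0); lia.
  by rewrite modnMDl modn_small //; lia.
have phi0 x : adj (v ord0) x ->
    exists2 j, j <= 2 * n & phi (v ord0) x = (2 * n).-1 + j.
  move=> /a_adj[j jn cE]; exists j; first by [].
  by rewrite (phi_mod _ _ _ _ cE) shift0.
have phi0_ex j : j <= 2 * n ->
    exists2 x, adj (v ord0) x & phi (v ord0) x = (2 * n).-1 + j.
  move=> jn; have [x vx cE] := a_ex j jn; exists x => //.
  by rewrite (phi_mod _ _ _ _ cE) shift0.
have phi_interval i : i != ord0 -> exists s,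
    (forall x, adj (v i) x -> exists2 j, j < 2 * n & phi (v i) x = s + j) /\
    (forall j, j < 2 * n -> exists2 x, adj (v i) x & phi (v i) x = s + j).
  move=> i0; have [b [b_adj b_ex]] := consecutive_mod_at_adj (c_consec (v i)).
  rewrite degree_clique (negbTE i0) addn0 in b_adj b_ex.
  have [j0 j0n /phi_mod cE] := b_adj (v ord0) i0.
  have vi : adj (v ord0) (v i) by rewrite adj_sym.
  have [k kn kE] := phi0 _ vi; rewrite phiC cE in kE.
  have [||s sE] := @cyclic_interval_unwrap t (2 * n) (b + h.+1) j0 j0n;
    rewrite ?kE; try lia.
  exists s; split=> [x /b_adj[j jn /phi_mod xE]|j jn].
    by exists j; rewrite // xE sE.
  by have [x ix /phi_mod xE] := b_ex j jn; exists x; rewrite // xE sE.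
(* Two candidates suffice, as [0] and [1] both differ from [2 n - 1]. *)
have [r r_le1 r_u] : exists2 r, r <= 1 & phi (v ord0) u %% (2 * n) != r.
  by case: (phi (v ord0) u %% (2 * n)) => [|k]; [exists 1|exists 0].
pose e (i j : 'I_(2 * n).+1) := (i != j) && (phi (v i) (v j) %% (2 * n) == r).
suff : ~~ odd (2 * n).+1 by rewrite mul2n /= odd_double.
apply: (@perfect_matching_even _ e).
- by move=> i j; rewrite /e eq_sym phiC.
- by move=> i; rewrite /e eqxx.
- move=> i.
  suff [x ix xr] : exists2 x, adj (v i) x & phi (v i) x %% (2 * n) = r.
    case: x ix xr => [j|[w|]] //= ix xr.
      by exists j; rewrite /e ix xr eqxx.
    by case/eqP: r_u; rewrite -xr (eqP ix).
  have [->|i0] := eqVneq i ord0.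
    have [|x vx xE] := phi0_ex r.+1; first by lia.
    exists x; rewrite // xE.
    have -> : (2 * n).-1 + r.+1 = 2 * n + r by lia.
    by rewrite modnDl modn_small //; lia.
  have [s [_ s_ex]] := phi_interval i i0.
  have [|j jn jr] := @interval_residue_exists (2 * n) s r; first by lia.
  by have [x ix xE] := s_ex j jn; exists x; rewrite // xE.
- move=> i j k /andP[ij /eqP jr] /andP[ik /eqP kr].
  suff /phi_inj : phi (v i) (v j) = phi (v i) (v k) by case/(_ ij ik).
  have [i0|i0] := eqVneq i ord0; last first.
    have [s [s_adj _]] := phi_interval i i0.
    have [p pn pE] := s_adj (v j) ij; have [q qn qE] := s_adj (v k) ik.
    rewrite pE qE; congr (_ + _); apply: (interval_residue_inj (s := s) pn qn).
    by rewrite -pE -qE jr kr.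
  (* The only color of residue [r] at [v_1] is [2 n + r]. *)
  rewrite {}i0 in ij ik jr kr *.
  have only_r x : adj (v ord0) x -> phi (v ord0) x %% (2 * n) = r ->
      phi (v ord0) x = 2 * n + r.
    move=> /phi0[[|p] pn ->].
      by rewrite addn0 modn_small; lia.
    have -> : (2 * n).-1 + p.+1 = 2 * n + p by lia.
    by rewrite modnDl modn_small // => ->.
  by rewrite (only_r (v j) ij jr) (only_r (v k) ik kr).
Qed.
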